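(* Consider a 0-1 knapsack instance with capacity $c$ and $n$ items with weights $w_1 \ge w_2 \ge \cdots \ge w_n$ (all parameters strictly positive integers, $\sum_{i=1}^n w_i > c$, and $w_i \le c$ for all $i$). Let $X$ be the set of inclusionwise maximal solutions, and for $1\le k\le c$ let $\text{numberIMSWeight}(k)=|\{\mathbf{x}\in X : \sum_{j=1}^n w_j x_j = k\}|$. For $1\le i\le n$ and $k\in\mathbb{Z}$ let $\text{numberSubsetsWeight}(i,k)$ be the number of subsets $A\subseteq\{1,\ldots,i-1\}$ with $\sum_{j\in A} w_j = k$. Then for every $k$ with $1\le k\le c$, $$\text{numberIMSWeight}(k)=\sum_{i=1}^{n} \begin{cases}\text{numberSubsetsWeight}\big(i,\,k-\sum_{j=i+1}^{n} w_j\big) & \text{if } c+1-w_i\le k\le c,\\ 0 & \text{otherwise.}\end{cases}$$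
   Context: A solution is a vector $\mathbf{x}\in\{0,1\}^n$. A solution $\mathbf{x}$ is inclusionwise maximal if $\sum_{i=1}^n w_i x_i \le c$ and there is no index $j$ with $x_j=0$ and $w_j+\sum_{i=1}^n w_i x_i \le c$. *)

(* Defs.v *)
From mathcomp Require Import all_boot all_order all_algebra.

Set Implicit Arguments.
Unset Strict Implicit.
Unset Printing Implicit Defensive.

(* The n items are indexed from 0 by 'I_n, so that items
   1, ..., i - 1 become the ordinals j < i. *)

(* A vector of {0,1}^n; the booleans coerce to 0 and 1. *)
Definition solution (n : nat) := {ffun 'I_n -> bool}.

Definition weight (n : nat) (w : 'I_n -> nat) (x : solution n) : nat :=
  \sum_(i < n) w i * x i.

Definition inclusionwise_maximal (n : nat) (w : 'I_n -> nat) (c : nat)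
    (x : solution n) : bool :=
  (weight w x <= c) &&
  ~~ [exists j : 'I_n, ~~ x j && (w j + weight w x <= c)].

Definition IMS (n : nat) (w : 'I_n -> nat) (c : nat) : {set solution n} :=
  [set x | inclusionwise_maximal w c x].

Definition numberIMSWeight (n : nat) (w : 'I_n -> nat) (c k : nat) : nat :=
  #|[set x in IMS w c | weight w x == k]|.

(* The target k is an integer, since it may be negative. *)
Definition numberSubsetsWeight (n : nat) (w : 'I_n -> nat) (i : 'I_n)
    (k : int) : nat :=
  #|[set A : {set 'I_n} | (A \subset [set j : 'I_n | j < i])
                          && (Posz (\sum_(j in A) w j) == k)]|.

(* Main.v *)
(* A knapsack solution of weight at most c omits some item. Let i be the last
   omitted one: it is the lightest omitted item, so maximality means exactly
   that i does not fit. The solution is then determined by its items before i,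
   all the items after i being selected. Counting by i gives the formula. *)
Require Import Defs.
From mathcomp Require Import all_boot all_order all_algebra.
From mathcomp Require Import zify.

Set Implicit Arguments.
Unset Strict Implicit.
Unset Printing Implicit Defensive.

Definition last_omitted (n : nat) (x : solution n) (i : 'I_n) : bool :=
  ~~ x i && [forall j : 'I_n, (i < j) ==> x j].

Lemma last_omittedP (n : nat) (x : solution n) (i : 'I_n) :
  reflect (x i = false /\ forall j : 'I_n, i < j -> x j) (last_omitted x i).
Proof.
apply: (iffP andP) => [[/negbTE xi /forallP xgt]|[xi xgt]]; split=> //.
- by move=> j; apply/implyP.
- by rewrite xi.
- by apply/forallP => j; apply/implyP/xgt.
Qed.

Lemma last_omitted_uniq (n : nat) (x : solution n) (i j : 'I_n) :
  last_omitted x i -> last_omitted x j -> i = j.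
Proof.
move=> /last_omittedP[xi xgti] /last_omittedP[xj xgtj]; apply/val_inj.
case: (ltngtP i j) => //; first by move/xgti; rewrite xj.
by move/xgtj; rewrite xi.
Qed.

(** If no item is omitted, the weight is the total weight, against the strict inequality; otherwise
    the greatest omitted index works. *)
Lemma exists_last_omitted (n : nat) (w : 'I_n -> nat) (x : solution n) :
  weight w x < \sum_(i < n) w i -> exists i, last_omitted x i.
Proof.
move=> ltx; have [j0 xj0|xT] := pickP (fun j => ~~ x j).
  case: (@arg_maxnP _ j0 (fun j => ~~ x j) (@nat_of_ord n) xj0) => i xi imax.
  exists i.
  apply/last_omittedP; split=> [|j ltij]; first exact: negbTE.
  by apply: contraLR ltij => /imax; rewrite -leqNgt.
move: ltx; rewrite /weight (eq_bigr w) ?ltnn // => i _.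
by move/negbFE: (xT i) => ->; rewrite muln1.
Qed.

(** Every omitted [j] satisfies [j <= i], hence [w i <= w j]: as soon as some omitted item fits, [i]
    fits too, so only [i] has to be tested. *)
Lemma inclusionwise_maximal_last_omitted (n : nat) (w : 'I_n -> nat) (c : nat)
    (x : solution n) (i : 'I_n) :
    (forall i j : 'I_n, i <= j -> w j <= w i) -> last_omitted x i ->
  inclusionwise_maximal w c x =
  (weight w x <= c) && (c < w i + weight w x).
Proof.
move=> w_noninc /last_omittedP[xi xgt]; rewrite /inclusionwise_maximal.
congr (_ && _); rewrite ltnNge; congr (~~ _).
apply/existsP/idP => [[j /andP[xj]]|lec]; last by exists i; rewrite xi.
apply: leq_trans; rewrite leq_add2r; apply: w_noninc.
by rewrite leqNgt; apply: contra xj => /xgt.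
Qed.

Definition complete (n : nat) (i : 'I_n) (A : {set 'I_n}) : solution n :=
  [ffun j => (j \in A) || (i < j)].

Lemma weight_complete (n : nat) (w : 'I_n -> nat) (i : 'I_n) (A : {set 'I_n}) :
    A \subset [set j : 'I_n | j < i] ->
  weight w (complete i A) = \sum_(j in A) w j + \sum_(j < n | i < j) w j.
Proof.
move=> /subsetP sA; rewrite /weight [in RHS]big_mkcond.
rewrite [X in _ = _ + X]big_mkcond -big_split /=; apply: eq_bigr => j _.
rewrite ffunE; case: (boolP (j \in A)) => [/sA|_].
  by rewrite inE => ltji; rewrite ltnNge ltnW //= muln1 addn0.
by case: (i < j) => /=; rewrite ?muln1 ?muln0.
Qed.

(** The restriction on [A] matters: indices beyond [i] are selected in [complete i A] whether or not
    they belong to [A]. *)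
Lemma complete_inj (n : nat) (i : 'I_n) :
  {in [pred A : {set 'I_n} | A \subset [set j : 'I_n | j < i]] &,
    injective (complete i)}.
Proof.
move=> A B /subsetP sA /subsetP sB /ffunP eqAB; apply/setP => j.
move: (eqAB j) (sA j) (sB j); rewrite !ffunE !inE.
case: (j \in A); case: (j \in B) => //= eqj.
  by move=> /(_ isT) ltji; rewrite ltnNge ltnW in eqj.
by move=> _ /(_ isT) ltji; rewrite ltnNge ltnW in eqj.
Qed.

(** [complete i] is a bijection from the subsets counted on the right to the solutions counted on
    the left. The subtraction is done in the integers, so that a tail heavier than [k] gives a
    negative target and a count of 0. *)
Lemma card_last_omitted (n : nat) (w : 'I_n -> nat) (i : 'I_n) (k : nat) :
  #|[set x : solution n | last_omitted x i && (weight w x == k)]| =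
  numberSubsetsWeight w i (Posz k - Posz (\sum_(j < n | i < j) w j)%N)%R.
Proof.
rewrite /numberSubsetsWeight; set D := [set A : {set _} | _].
have sD A : A \in D -> A \subset [set j : 'I_n | j < i].
  by rewrite inE => /andP[].
rewrite -(@card_in_imset _ _ (complete i) D); last first.
  by move=> A B /sD sA /sD sB; apply: complete_inj.
apply: eq_card => x; rewrite inE.
apply/andP/imsetP => [[/last_omittedP[xi xgt] /eqP wx]|[A AD ->]]; last first.
  have sA := sD A AD; rewrite weight_complete //; split.
    apply/last_omittedP; split=> [|j ltij]; rewrite ffunE ?ltij ?orbT //.
    rewrite ltnn orbF; apply/negbTE/negP => /(subsetP sA).
    by rewrite inE ltnn.
  by move: AD; rewrite inE => /andP[_ /eqP]; lia.
(* The preimage of [x] keeps its items before [i]; the later ones are restored by [complete i]. *)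
pose A := [set j : 'I_n | (j < i) && x j].
have sA : A \subset [set j : 'I_n | j < i].
  by apply/subsetP => j; rewrite !inE => /andP[].
have xE : x = complete i A.
  apply/ffunP => j; rewrite ffunE inE.
  case: (ltngtP j i) => [_|/xgt ->|/val_inj ->] //=; by rewrite ?orbF.
exists A => //; rewrite inE sA /=; move: wx; rewrite xE weight_complete //.
by move=> <-; rewrite PoszD GRing.addrK.
Qed.

Theorem theorem1 (n c : nat) (w : 'I_n -> nat)
  (n_gt0 : 0 < n) (c_gt0 : 0 < c)
  (w_gt0 : forall i : 'I_n, 0 < w i)
  (w_noninc : forall i j : 'I_n, i <= j -> w j <= w i)
  (sum_w_gt : c < \sum_(i < n) w i)
  (w_le_c : forall i : 'I_n, w i <= c)
  (k : nat) (hk : 1 <= k <= c) :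
  numberIMSWeight w c k =
  \sum_(i < n)
    (if (Posz c + 1 - Posz (w i) <= Posz k <= Posz c)%R then
       numberSubsetsWeight w i (Posz k - Posz (\sum_(j < n | i < j) w j)%N)%R
     else 0).

Proof.
have [k_gt0 k_le_c] := andP hk.
(* Double counting of pairs of a solution and its last omitted index: after exchanging the sums,
   each solution of weight [k] contributes exactly 1, since [k <= c] is below the total weight and
   the index is unique. *)
have -> : numberIMSWeight w c k =
    \sum_(i < n) #|[set x in IMS w c | (weight w x == k) && last_omitted x i]|.
  under eq_bigr => i _ do rewrite -sum1dep_card.
  rewrite /numberIMSWeight -sum1dep_card.
  rewrite (exchange_big_dep (fun x => (x \in IMS w c) && (weight w x == k))) /=.
    apply: eq_bigr => x /andP[xIMS /eqP wx].
    have [|i xi] := @exists_last_omitted _ w x.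
      by rewrite wx (leq_ltn_trans k_le_c).
    rewrite (big_pred1 i) // => j; rewrite xIMS wx eqxx /=.
    by apply/idP/eqP => [xj|->] //; exact: last_omitted_uniq xi.
  by move=> i x _ /and3P[-> ->].
apply: eq_bigr => i _; rewrite -card_last_omitted.
(* As [k <= c] is given, the case condition says just that item [i] does not fit on top of weight
   [k]. *)
have -> : (Posz c + 1 - Posz (w i) <= Posz k <= Posz c)%R = (c < w i + k).
  by apply/idP/idP; lia.
(* When [c < w i + k], maximality is automatic for the solutions of weight [k] whose last omitted
   item is [i]; otherwise none of them is maximal. *)
case: ifP => fits; [apply: eq_card => x | apply: eq_card0 => x].
  rewrite !inE [RHS]andbC; case: eqP => [wx|_]; last by rewrite /= andbF.
  case: (boolP (last_omitted x i)) => [xi|_]; last by rewrite /= andbF.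
  by rewrite (inclusionwise_maximal_last_omitted c w_noninc xi) wx k_le_c fits.
rewrite !inE; apply/negP => /and3P[xmax /eqP wx xi]; move: xmax.
by rewrite (inclusionwise_maximal_last_omitted c w_noninc xi) wx fits andbF.
Qed.
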